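(* For each integer $d\ge 2$ let $M=M_d$ denote $\mathbb{T}^d$ (respectively, for all $d$, let $M=M_d$ denote $\mathbb{R}^d$). For a smooth vector field $u_0^{(d)}:M\to\mathbb{R}^d$ let $u^{(d)}(x,t)$ denote the solution of the multidimensional Burgers equation $\partial_t u+u\cdot\nabla u=0$ on $M$ with $u|_{t=0}=u_0^{(d)}$. The following two statements hold. (1) For any smooth vector field $u_0^{(d)}:M\to\mathbb{R}^d$ with $\|\nabla u_0^{(d)}\|_{L^\infty}<\infty$ and all $t\ge 0$ with $t\,\|\nabla u_0^{(d)}\|_{L^\infty}<1$, $$\|\nabla u^{(d)}(\cdot,t)\|_{L^\infty}\le \frac{\|\nabla u_0^{(d)}\|_{L^\infty}}{1-t\,\|\nabla u_0^{(d)}\|_{L^\infty}}.$$ (2) There exists a family $\{u_0^{(d)}\}_{d\ge 2}$ of smooth vector fields $u_0^{(d)}:M\to\mathbb{R}^d$ whose gradients $\nabla u_0^{(d)}(x)$ are nilpotent $d\times d$ matrices for every $x\in M$, such that $\|\nabla u_0^{(d)}\|_{L^\infty}=1$ for every $d$, and for all $t\in[0,1]$ $$\lim_{d\to\infty}\|\nabla u^{(d)}(\cdot,t)\|_{L^\infty}=\frac{1}{1-t},$$ where for $t=1$ the right-hand side is interpreted as $+\infty$.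
   Context: For a real $d\times d$ matrix $A=(a_{ij})$, $\|A\|:=\max_{1\le i\le d}\sum_{j=1}^d|a_{ij}|$ (maximum absolute row sum), and for a matrix field $A$ on $M$, $\|A\|_{L^\infty}:=\sup_{x\in M}\|A(x)\|$. The gradient is $(\nabla u)_{ij}=\partial_j u_i$. When $\nabla u_0(x)$ is nilpotent for every $x$, the Burgers solution exists for all times, is divergence free, and is a pressureless ($\nabla p=0$) solution of the incompressible Euler equations on $M$. *)

(* Defs.v *)
From HB Require Import structures.
From mathcomp Require Import all_boot all_order all_algebra.
From mathcomp Require Import all_classical all_reals all_analysis.

Set Implicit Arguments.
Unset Strict Implicit.
Unset Printing Implicit Defensive.

Import Order.TTheory GRing.Theory Num.Theory.
Import numFieldNormedType.Exports.

Local Open Scope classical_set_scope.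
Local Open Scope ring_scope.

Inductive manifold := Euclidean | Torus.

(* T^d = R^d / Z^d: maps on the torus are the Z^d-periodic maps on R^d. *)
Definition lives_on (R : realType) (d : nat) (M : manifold)
    (v : 'rV[R]_d -> 'rV[R]_d) : Prop :=
  match M with
  | Euclidean => True
  | Torus => forall j : 'I_d, periodic v (delta_mx 0 j)
  end.

Definition partial (R : realType) (d : nat) (j : 'I_d) (f : 'rV[R]_d -> R)
    (x : 'rV[R]_d) : R :=
  'D_(delta_mx 0 j) f x.

Definition grad (R : realType) (d : nat) (v : 'rV[R]_d -> 'rV[R]_d)
    (x : 'rV[R]_d) : 'M[R]_d :=
  \matrix_(i, j) partial j (fun y => v y 0 i) x.

Fixpoint Ck (R : realType) (d k : nat) (f : 'rV[R]_d -> R) : Prop :=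
  match k with
  | 0%N => continuous f
  | k'.+1 => (forall x, differentiable f x) /\ forall j, Ck k' (partial j f)
  end.

Definition smooth_field (R : realType) (d : nat) (M : manifold)
    (v : 'rV[R]_d -> 'rV[R]_d) : Prop :=
  lives_on M v /\ forall (i : 'I_d) (k : nat), Ck k (fun x => v x 0 i).

Definition rowsum_norm (R : realType) (d : nat) (A : 'M[R]_d) : R :=
  \big[Num.max/0]_(i < d) \sum_(j < d) `|A i j|.

Definition Linf_norm (R : realType) (d : nat) (A : 'rV[R]_d -> 'M[R]_d) :
    \bar R :=
  ereal_sup [set (rowsum_norm (A x))%:E | x in setT].

Definition nilpotent_mx (R : realType) (d : nat) (A : 'M[R]_d) : Prop :=
  exists k : nat, A ^+ k = 0.

(* Classical solutions on M x I, where I is a time interval of the form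
   [0, T) with 0 < T <= +oo: continuous up to t = 0, continuously
   differentiable in space-time for t > 0.  The values of u outside I are
   irrelevant. *)
Record burgers_solution (R : realType) (d : nat) (M : manifold) (I : set R)
    (u0 : 'rV[R]_d -> 'rV[R]_d) (u : 'rV[R]_d -> R -> 'rV[R]_d) : Prop := {
  burgers_domain : forall t : R, I t -> lives_on M (u ^~ t);
  burgers_continuous :
    {within [set p : 'rV[R]_d * R | I p.2], continuous (fun p => u p.1 p.2)};
  burgers_differentiable : forall (x : 'rV[R]_d) (t : R), I t -> 0 < t ->
    differentiable (fun p : 'rV[R]_d * R => u p.1 p.2) (x, t);
  burgers_continuous_grad : forall (x : 'rV[R]_d) (t : R), I t -> 0 < t ->
    {for (x, t), continuous (fun p : 'rV[R]_d * R => grad (u ^~ p.2) p.1)};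
  burgers_continuous_dt : forall (x : 'rV[R]_d) (t : R), I t -> 0 < t ->
    {for (x, t), continuous (fun p : 'rV[R]_d * R => derive1 (u p.1) p.2)};
  burgers_equation : forall (x : 'rV[R]_d) (t : R), I t -> 0 < t -> forall i : 'I_d,
    derive1 (u x) t 0 i + \sum_(j < d) u x t 0 j * grad (u ^~ t) x i j = 0;
  burgers_initial : forall x, u x 0 = u0 x
}.

(* "u is the solution": u solves the problem and every solution on M x I
   coincides with it. *)
Definition is_the_burgers_solution (R : realType) (d : nat) (M : manifold)
    (I : set R) (u0 : 'rV[R]_d -> 'rV[R]_d)
    (u : 'rV[R]_d -> R -> 'rV[R]_d) : Prop :=
  burgers_solution M I u0 u /\
  forall v, burgers_solution M I u0 v -> forall x t, I t -> v x t = u x t.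

(* Main.v *)
Require Import Defs.
From HB Require Import structures.
From mathcomp Require Import all_boot all_order all_algebra.
From mathcomp Require Import all_classical all_reals all_analysis.
From mathcomp Require Import ring lra.

Set Implicit Arguments.
Unset Strict Implicit.
Unset Printing Implicit Defensive.

Import Order.TTheory GRing.Theory Num.Theory.
Import numFieldNormedType.Exports.

Local Open Scope classical_set_scope.
Local Open Scope ring_scope.

(** The flow of the Burgers equation moves points along straight lines carrying
    the constant velocity given by the datum, so a solution is
    [u(x, t) = u0(y)] where [y] is the foot of the line reaching [x] at time
    [t], i.e. [y + t u0(y) = x]. Everything reduces to inverting the maps
    [y |-> y + t u0(y)].

    Suppose that for [t] in an open set of times these maps have a jointly
    continuous inverse [Y(., t)] and invertible differentials [1 + t A], with
    [A = grad u0]; this is the record [flow_inverse]. An elementary inverse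
    function argument ([differentiable_right_inverse]) makes [Y], hence
    [u = u0 o Y], differentiable in space-time, and differentiating
    [u = u0(x - t u)] gives at once
    - the Burgers equation: [w = u_t + (u . grad) u] satisfies [w = - t A w],
      and [1 + t A] is injective;
    - the resolvent identity [G = A - t A G] for [G = grad u(., t)]
      ([flow_grad]), that is [G = (1 + t A)^-1 A].
    Conversely, along the straight line of velocity [v(x, t)] through [(x, t)],
    the deviation of any solution [v] from [v(x, t)] solves a linear ODE and
    vanishes at time [t], hence vanishes down to time [0]: so [v(x, t)] is the
    value of [u0] at the foot of that line ([burgers_foot]). Uniqueness of
    feet then gives uniqueness of solutions ([flow_solution]).

    The maximum row sum is the operator norm for the sup norm on vectors.
    Therefore it is submultiplicative, the identity [G = A - t A G] yields
    [|G| <= |A| / (1 - t |A|)], and a bound [N] on [|grad u0|] is a Lipschitz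
    constant of [u0] for the sup norm. When [t N < 1], Banach's fixed point
    theorem for [y |-> x - t u0(y)] provides the inverse ([flow_inverse_foot]);
    this proves the first statement.

    The bound is asymptotically sharp because [G = sum_k (- t)^k A^(k + 1)]: if
    [A] is the opposite of the nilpotent shift matrix, all terms have the same
    sign and the first row of [G] sums to [- (1 + t + ... + t^(d - 2))], which
    tends to [- 1 / (1 - t)]. The periodic field
    [u0_i(x) = - sin(2 pi x_(i + 1)) / (2 pi)] has this gradient at the origin
    and everywhere a gradient supported on the same superdiagonal with entries
    at most [1], and it serves on the torus and on the whole space alike. As
    component [i] depends on component [i + 1] only, the iterates of
    [y |-> x - t u0(y)] become stationary after [d] steps, which gives the
    inverse for all times. *)

(** * Calculus in coordinates *)

Lemma coord_le_norm (R : realType) d (v : 'rV[R]_d) i : `|v 0 i| <= `|v|.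
Proof.
rewrite [leRHS]/Num.Def.normr/= mx_normrE.
exact: (le_bigmax _ (fun ij : 'I_1 * 'I_d => `|v ij.1 ij.2|) (0, i)).
Qed.

Lemma norm_le_coord (R : realType) d (v : 'rV[R]_d) e : 0 <= e ->
  (forall i, `|v 0 i| <= e) -> `|v| <= e.
Proof.
move=> e0 ve; rewrite [leLHS]/Num.Def.normr/= mx_normrE bigmax_le// => -[i j] _.
by rewrite ord1.
Qed.

Lemma cvg_mx_coord (R : realType) (T : Type) (F : set_system T) m n
    (M : T -> 'M[R]_(m, n)) (L : 'M[R]_(m, n)) : Filter F ->
  (forall i j, (fun x => M x i j) @ F --> L i j) -> M @ F --> L.
Proof.
move=> FF ML; apply/cvgrPdist_le => /= e e0.
near=> x.
rewrite [leLHS]/Num.Def.normr/= mx_normrE (bigmax_le _ (ltW e0))//= => i _.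
rewrite !mxE/=.
move: i; near: x; apply: filter_forall => /= i.
exact: ((cvgrPdist_le _ _).1 (ML i.1 i.2)).
Unshelve. all: by end_near. Qed.

Lemma differentiable_rV (R : realType) (V : normedModType R) d
    (f : V -> 'rV[R]_d) x :
  (forall i, differentiable (fun y => f y 0 i) x) -> differentiable f x.
Proof.
move=> df.
have -> : f = \sum_(i < d) (fun y => f y 0 i *: delta_mx 0 i).
  by apply/funext => y; rewrite fct_sumE [LHS]row_sum_delta.
by apply: differentiable_sum => i; exact: differentiableZl.
Qed.

Lemma diff_coord (R : realType) (V : normedModType R) d
    (f : V -> 'rV[R]_d) x i h : differentiable f x ->
  differentiable (fun y => f y 0 i) x /\
  'd (fun y => f y 0 i) x h = ('d f x h) 0 i.
Proof.
move=> df.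
have lin : linear (fun N : 'rV[R]_d => N 0 i) by move=> a u v; rewrite !mxE.
pose gM := GRing.isLinear.Build _ _ _ _ _ lin.
pose g : {linear 'rV[R]_d -> R} := HB.pack (fun N : 'rV[R]_d => N 0 i) gM.
have cg : continuous g by exact: coord_continuous.
have dg := linear_differentiable (f x) cg.
split; first exact: (differentiable_comp df dg).
by rewrite (diff_comp df dg)/= (diff_lin _ cg).
Qed.

Lemma diff_partial (R : realType) d (f : 'rV[R]_d -> R) x h :
  differentiable f x -> 'd f x h = \sum_j h 0 j * partial j f x.
Proof.
move=> df; rewrite {1}[h]row_sum_delta linear_sum; apply: eq_bigr => j _.
by rewrite linearZ /partial deriveE.
Qed.

Lemma diff_grad (R : realType) d (v : 'rV[R]_d -> 'rV[R]_d) x h :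
  differentiable v x -> 'd v x h = h *m (grad v x)^T.
Proof.
move=> dv; apply/rowP => i; have [dvi <-] := diff_coord i h dv.
rewrite diff_partial// !mxE; apply: eq_bigr => j _.
by rewrite !mxE.
Qed.

Lemma coord_cvg (R : realType) (T : Type) (F : set_system T) m n
    (M : T -> 'M[R]_(m, n)) (L : 'M[R]_(m, n)) i j : Filter F ->
  M @ F --> L -> (fun x => M x i j) @ F --> L i j.
Proof.
move=> FF ML; exact: (@cvg_comp _ _ _ M (fun A : 'M[R]_(m, n) => A i j) F
  (nbhs L) (nbhs (L i j)) ML (@coord_continuous _ _ _ i j L)).
Qed.

(** * Differentiability of a continuous inverse *)

Lemma differentiable_of_bound (R : realType) (V W : normedModType R)
    (f : V -> W) x (L : {linear V -> W}) : continuous L ->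
  (forall e, 0 < e -> \forall h \near (0 : V),
     `|f (h + x) - f x - L h| <= e * `|h|) ->
  differentiable f x.
Proof.
move=> cL fL.
have E : f \o shift x = cst (f x) + L +o_ 0 id.
  apply/eqaddoP => e e0; near=> h => /=.
  have -> : (f \o shift x - (cst (f x) + L)) h = f (h + x) - f x - L h.
    by rewrite -addrA -opprD.
  by near: h; exact: fL.
by apply/diff_locallyP; rewrite (diff_unique cL E).
Unshelve. all: by end_near. Qed.

(** With [k = G(p + h) - G(p)], differentiability of [F] at [G p] says that
    [h = dF k + o(k)], so [L h = k + o(k)]. Since [L] is bounded this first
    gives [k = O(h)], and then [k = L h + o(h)]. *)
Lemma differentiable_right_inverse (R : realType) (V W : normedModType R)
    (F : V -> W) (G : W -> V) p (L : {linear W -> V}) :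
  continuous L -> differentiable F (G p) ->
  (forall h, L ('d F (G p) h) = h) ->
  {for p, continuous G} -> (\forall q \near p, F (G q) = q) ->
  differentiable G p.
Proof.
move=> cL dF LK cG FK; apply: (differentiable_of_bound cL) => e e0.
have [c c0 Lc] := linear_lipschitz cL.
(* The first bound on eta gives [k = O(h)], the second one the final [e]. *)
pose eta := Num.min (1 / (2 * c)) (e / (2 * c * c)).
have eta0 : 0 < eta by rewrite lt_min !divr_gt0// !mulr_gt0.
have eta1 : c * eta <= 1 / 2.
  rewrite mulrC -ler_pdivlMr// ge_min; apply/orP; left.
  by rewrite invfM mulrA.
have eta2 : 2 * c * c * eta <= e.
  by rewrite mulrC -ler_pdivlMr ?mulr_gt0// ge_min lexx orbT.
have FGp : F (G p) = p by exact: nbhs_singleton FK.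
have dFo : \forall k \near (0 : V),
    `|F (k + G p) - F (G p) - 'd F (G p) k| <= eta * `|k|.
  have /eqaddoP/(_ _ eta0) := diff_locally dF.
  apply: filterS => k.
  have -> : (F \o shift (G p) - (cst (F (G p)) + 'd F (G p))) k
          = F (k + G p) - F (G p) - 'd F (G p) k by rewrite -addrA -opprD.
  by [].
have Gp0 : G (h + p) - G p @[h --> 0] --> (0 : V).
  rewrite -(subrr (G p)); apply: cvgB; last exact: cvg_cst.
  by rewrite -[X in X @ _]/(G \o shift p) cvg_comp_shift add0r.
have := Gp0 _ dFo; rewrite /nbhs/= => dFG.
have FKh : \forall h \near (0 : W), F (G (h + p)) = h + p.
  have : (fun h : W => h + p) @ (0 : W) --> p.
    rewrite -{2}[p]add0r; apply: cvgD; [exact: cvg_id|exact: cvg_cst].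
  by move=> /(_ _ FK).
near=> h.
have : `|F (G (h + p) - G p + G p) - F (G p) - 'd F (G p) (G (h + p) - G p)|
      <= eta * `|G (h + p) - G p| by near: h.
rewrite subrK (near FKh h)// FGp addrK.
set k := G (h + p) - G p => hk.
have kL : `|k - L h| <= c * (eta * `|k|).
  have -> : k - L h = - L (h - 'd F (G p) k) by rewrite linearB LK opprB.
  rewrite normrN.
  exact: le_trans (Lc _) (ler_wpM2l (ltW c0) hk).
have k2 : `|k| <= 2 * c * `|h|.
  have kLh : `|k| <= `|k - L h| + `|L h|.
    by rewrite -{1}(subrK (L h) k) ler_normD.
  have := Lc h.
  have : c * (eta * `|k|) <= 1 / 2 * `|k| by rewrite mulrA ler_wpM2r.
  by move: kLh kL; lra.
apply: (le_trans kL); rewrite mulrA.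
apply: (@le_trans _ _ (c * eta * (2 * c * `|h|))).
  by rewrite ler_wpM2l// mulr_ge0// ltW.
have -> : c * eta * (2 * c * `|h|) = 2 * c * c * eta * `|h| by ring.
by rewrite ler_wpM2r.
Unshelve. all: by end_near. Qed.

(** * The maximum row sum norm and invertible matrices *)

Lemma row_le_rowsum (R : realType) d (A : 'M[R]_d) i :
  \sum_j `|A i j| <= rowsum_norm A.
Proof. exact: (le_bigmax _ (fun i => \sum_j `|A i j|)). Qed.

Lemma rowsum_norm_le (R : realType) d (A : 'M[R]_d) e : 0 <= e ->
  (forall i, \sum_j `|A i j| <= e) -> rowsum_norm A <= e.
Proof. by move=> e0 Ae; rewrite /rowsum_norm bigmax_le. Qed.

Lemma rowsum_norm_ge0 (R : realType) d (A : 'M[R]_d) : 0 <= rowsum_norm A.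
Proof. exact: bigmax_ge_id. Qed.

Lemma rowsum_normB (R : realType) d (A B : 'M[R]_d) :
  rowsum_norm (A - B) <= rowsum_norm A + rowsum_norm B.
Proof.
apply: rowsum_norm_le => [|i]; first by rewrite addr_ge0// rowsum_norm_ge0.
apply: le_trans (lerD (row_le_rowsum A i) (row_le_rowsum B i)).
by rewrite -big_split/=; apply: ler_sum => j _; rewrite !mxE ler_normB.
Qed.

Lemma rowsum_normM (R : realType) d (A B : 'M[R]_d) :
  rowsum_norm (A *m B) <= rowsum_norm A * rowsum_norm B.
Proof.
apply: rowsum_norm_le => [|i]; first by rewrite mulr_ge0// rowsum_norm_ge0.
apply: (@le_trans _ _ (\sum_j \sum_k `|A i k| * `|B k j|)).
  apply: ler_sum => j _; rewrite mxE; apply: le_trans (ler_norm_sum _ _ _) _.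
  by apply: ler_sum => k _; rewrite normrM.
rewrite exchange_big/=.
apply: (@le_trans _ _ (\sum_k `|A i k| * rowsum_norm B)).
  by apply: ler_sum => k _; rewrite -mulr_sumr ler_wpM2l// row_le_rowsum.
by rewrite -mulr_suml ler_wpM2r ?rowsum_norm_ge0// row_le_rowsum.
Qed.

Lemma rowsum_normZ_le (R : realType) d t (A : 'M[R]_d) :
  rowsum_norm (t *: A) <= `|t| * rowsum_norm A.
Proof.
apply: rowsum_norm_le => [|i]; first by rewrite mulr_ge0// rowsum_norm_ge0.
apply: le_trans (ler_wpM2l (normr_ge0 t) (row_le_rowsum A i)).
by rewrite mulr_sumr; apply: ler_sum => j _; rewrite mxE normrM.
Qed.

(** The row sums of [A] bound the action of [A] on column vectors for the sup
    norm; vectors being rows here, [A] acts by its transpose. *)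
Lemma norm_mul_tr (R : realType) d (h : 'rV[R]_d) (A : 'M[R]_d) :
  `|h *m A^T| <= rowsum_norm A * `|h|.
Proof.
apply: norm_le_coord => [|i]; first by rewrite mulr_ge0// rowsum_norm_ge0.
apply: le_trans (ler_wpM2r (normr_ge0 h) (row_le_rowsum A i)).
rewrite mxE mulr_suml; apply: le_trans (ler_norm_sum _ _ _) _.
by apply: ler_sum => j _; rewrite !mxE normrM mulrC ler_wpM2l// coord_le_norm.
Qed.

(** Taking norms in the equation gives [|G| <= N + t N |G|], which can be solved
    for [|G|] because [t N < 1]; no inverse matrix has to be computed. *)
Lemma rowsum_norm_resolvent (R : realType) d (A G : 'M[R]_d) t N :
  0 <= t -> t * N < 1 -> rowsum_norm A <= N -> G = A - t *: (A *m G) ->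
  rowsum_norm G <= N / (1 - t * N).
Proof.
move=> t0 tN AN GE; rewrite ler_pdivlMr ?subr_gt0//.
have GA : rowsum_norm G <= N + t * (N * rowsum_norm G).
  rewrite {1}GE; apply: le_trans (rowsum_normB _ _) (lerD AN _).
  apply: le_trans (rowsum_normZ_le _ _) _; rewrite ger0_norm// ler_wpM2l//.
  apply: le_trans (rowsum_normM _ _) _.
  by rewrite ler_wpM2r// rowsum_norm_ge0.
by move: GA; lra.
Qed.

Lemma unitmx_inj (F : fieldType) d (B : 'M[F]_d) :
  (forall v : 'rV_d, v *m B = 0 -> v = 0) -> B \in unitmx.
Proof.
move=> inj; rewrite -row_free_unit -kermx_eq0; apply/eqP/row_matrixP => i.
by rewrite row0; apply: inj; rewrite -row_mul mulmx_ker row0.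
Qed.

(** If [v (1 + t A) = 0] then [|v| = |t v A| <= |t| |A| |v|], which forces
    [v = 0]. The transposes put [A] in the form required by [norm_mul_tr]. *)
Lemma unitmx_small_perturbation (R : realType) d (A : 'M[R]_d) t :
  `|t| * rowsum_norm A < 1 -> 1%:M + t *: A \in unitmx.
Proof.
move=> tA; rewrite -unitmx_tr; apply: unitmx_inj => v.
rewrite linearD/= trmx1 mulmxDr mulmx1 => /eqP; rewrite addr_eq0 => /eqP vE.
apply/eqP; rewrite -normr_le0; move: (norm_mul_tr v (t *: A)).
rewrite -normrN -vE => le1.
have le2 : rowsum_norm (t *: A) * `|v| <= `|t| * rowsum_norm A * `|v|.
  by rewrite ler_wpM2r// rowsum_normZ_le.
have := normr_ge0 v; move: tA le1 le2; set a := `|t| * _; nra.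
Qed.

Lemma cvg_det (R : realType) (T : Type) (F : set_system T) d
    (M : T -> 'M[R]_d) (L : 'M[R]_d) : Filter F ->
  (forall i j, (fun x => M x i j) @ F --> L i j) ->
  (fun x => \det (M x)) @ F --> \det L.
Proof.
move=> FF ML; rewrite /determinant; apply: cvg_big => [|s _].
  exact: add_continuous.
apply: cvgM; first exact: cvg_cst.
by apply: cvg_big => [|i _]; [exact: mul_continuous|exact: ML].
Qed.

(** By Cramer's rule the entries of the inverse are cofactors divided by the
    determinant, and near the limit the determinant does not vanish. *)
Lemma cvg_invmx (R : realType) (T : Type) (F : set_system T) d
    (M : T -> 'M[R]_d) (L : 'M[R]_d) : Filter F -> L \in unitmx ->
  (forall i j, (fun x => M x i j) @ F --> L i j) ->
  forall i j, (fun x => invmx (M x) i j) @ F --> invmx L i j.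
Proof.
move=> FF uL ML i j; have detL := cvg_det FF ML.
have nz : \det L != 0 by move: uL; rewrite unitmxE unitfE.
rewrite {2}/invmx uL !mxE.
apply: (@cvg_trans _ ((fun x => (\det (M x))^-1 * cofactor (M x) j i) @ F)).
  apply: near_eq_cvg; near=> x.
  have : \det (M x) != 0 by near: x; exact: cvgr_neq0 detL nz.
  by rewrite -unitfE -unitmxE /invmx => ->; rewrite !mxE.
apply: cvgM; first exact: cvgV.
apply: cvgM; first exact: cvg_cst.
apply: cvg_det => k l; rewrite !mxE.
by under eq_fun do rewrite !mxE; exact: ML.
Unshelve. all: by end_near. Qed.

Lemma cvg_mulmx (R : realType) (T : Type) (F : set_system T) m n p
    (M : T -> 'M[R]_(m, n)) (N : T -> 'M[R]_(n, p)) (L : 'M[R]_(m, n)) (K : 'M[R]_(n, p)) :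
  Filter F ->
  (forall i j, (fun x => M x i j) @ F --> L i j) ->
  (forall i j, (fun x => N x i j) @ F --> K i j) ->
  forall i j, (fun x => (M x *m N x) i j) @ F --> (L *m K) i j.
Proof.
move=> FF ML NK i j; under eq_fun do rewrite mxE; rewrite mxE.
apply: cvg_big => [|k _]; first exact: add_continuous.
exact: cvgM.
Qed.

(** * Characteristics *)

Lemma is_diff_fst (R : realType) (V W : normedModType R) (p : V * W) :
  is_diff p fst fst.
Proof.
have lin : linear (fst : V * W -> V) by [].
pose gM := GRing.isLinear.Build _ _ _ _ _ lin.
pose g : {linear (V * W)%type -> V} := HB.pack (fst : V * W -> V) gM.
have cg : continuous g by move=> q; exact: cvg_fst.
apply: DiffDef; first exact: (linear_differentiable p cg).
exact: (diff_lin p cg).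
Qed.

Lemma is_diff_snd (R : realType) (V W : normedModType R) (p : V * W) :
  is_diff p snd snd.
Proof.
have lin : linear (snd : V * W -> W) by [].
pose gM := GRing.isLinear.Build _ _ _ _ _ lin.
pose g : {linear (V * W)%type -> W} := HB.pack (snd : V * W -> W) gM.
have cg : continuous g by move=> q; exact: cvg_snd.
apply: DiffDef; first exact: (linear_differentiable p cg).
exact: (diff_lin p cg).
Qed.

Lemma diff_scale (R : realType) (V : normedModType R) d (k : V -> R)
    (f : V -> 'rV[R]_d) x : differentiable k x -> differentiable f x ->
  differentiable (fun z => k z *: f z) x /\
  forall h, 'd (fun z => k z *: f z) x h = k x *: 'd f x h + 'd k x h *: f x.
Proof.
move=> dk df.
have E i : (fun z => (k z *: f z) 0 i) = (k * (fun z => f z 0 i)).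
  by apply/funext => z; rewrite mxE.
have dfi i := (diff_coord i 0 df).1.
have dkf : differentiable (fun z => k z *: f z) x.
  by apply: differentiable_rV => i; rewrite E; exact: differentiableM.
split=> // h; apply/rowP => i.
rewrite -(diff_coord i h dkf).2 E diffM// !mxE -(diff_coord i h df).2.
by rewrite -[LHS]/(k x * _ + f x 0 i * _) [X in _ + X]mulrC.
Qed.

(** The partial gradient and the time derivative are the restrictions of the
    space-time differential; this lets the Burgers equation be read as a
    statement about a single differential. *)
Lemma diff_slices (R : realType) d (v : 'rV[R]_d -> R -> 'rV[R]_d) x t :
  differentiable (fun p : 'rV[R]_d * R => v p.1 p.2) (x, t) ->
  (forall h, 'd (fun p : 'rV[R]_d * R => v p.1 p.2) (x, t) (h, 0)
     = h *m (grad (v ^~ t) x)^T) /\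
  'd (fun p : 'rV[R]_d * R => v p.1 p.2) (x, t) (0, 1) = derive1 (v x) t.
Proof.
set V := fun p : 'rV[R]_d * R => v p.1 p.2 => dV.
split=> [h|].
  have di : is_diff x (fun y : 'rV[R]_d => (y, t)) (fun k => (k, 0)).
    exact: is_diff_pair.
  have dV' : is_diff ((fun y : 'rV[R]_d => (y, t)) x) V ('d V (x, t)).
    exact: differentiableP.
  have dvt := is_diff_comp di dV'.
  by rewrite -diff_grad; [rewrite (@diff_val _ _ _ _ _ _ _ dvt)|exact: ex_diff].
have di : is_diff t (fun s : R => (x, s)) (fun k => (0, k)).
  exact: is_diff_pair.
have dV' : is_diff ((fun s : R => (x, s)) t) V ('d V (x, t)).
  exact: differentiableP.
have dvt := is_diff_comp di dV'.
by rewrite derive1E'; [rewrite (@diff_val _ _ _ _ _ _ _ dvt)|exact: ex_diff].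
Qed.

(** The characteristic of [u0] issued from [y] is [t |-> y + t u0(y)]. The
    record says that at the times of [T] the characteristics fill the space
    without crossing, [Y x t] being the foot of the one that passes through [x]
    at time [t]. Continuity is joint, and [T] is an open set of times, so that
    both can be used in neighbourhoods of space-time points. *)
Record flow_inverse (R : realType) d (T : set R) (u0 : 'rV[R]_d -> 'rV[R]_d)
    (Y : 'rV[R]_d -> R -> 'rV[R]_d) : Prop := {
  flow_C1 : forall i, Ck 1 (fun x => u0 x 0 i);
  flow_open : open T;
  flow_right_inverse : forall x t, T t -> Y x t + t *: u0 (Y x t) = x;
  flow_unique : forall x y t, T t -> y + t *: u0 y = x -> y = Y x t;
  flow_continuous : forall x t, T t ->
    {for (x, t), continuous (fun p : 'rV[R]_d * R => Y p.1 p.2)};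
  flow_unit : forall x t, T t -> 1%:M + t *: grad u0 x \in unitmx }.

Lemma C1_differentiable (R : realType) d (u0 : 'rV[R]_d -> 'rV[R]_d) :
  (forall i, Ck 1 (fun x => u0 x 0 i)) -> forall x, differentiable u0 x.
Proof. by move=> C1 x; apply: differentiable_rV => i; have [] := C1 i. Qed.

Lemma C1_grad_continuous (R : realType) d (u0 : 'rV[R]_d -> 'rV[R]_d) i j :
  (forall i, Ck 1 (fun x => u0 x 0 i)) -> continuous (fun x => grad u0 x i j).
Proof.
move=> C1; have [_ /(_ j)/=] := C1 i.
have -> // : partial j (fun x => u0 x 0 i) = (fun x => grad u0 x i j).
by apply/funext => x; rewrite mxE.
Qed.

Lemma near_time (R : realType) (V : normedModType R) (T : set R) (x : V) t :
  open T -> T t -> \forall p \near (x, t), T p.2.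
Proof.
move=> oT Tt; have : snd @ nbhs (x, t) --> t by exact: cvg_snd.
by apply; exact: open_nbhs_nbhs.
Qed.

(** Apply [differentiable_right_inverse] to the space-time flow
    [F(y, s) = (y + s u0(y), s)], whose inverse is [(x, s) |-> (Y x s, s)]. *)
Lemma flow_differentiable (R : realType) d (T : set R) u0
    (Y : 'rV[R]_d -> R -> 'rV[R]_d) (x : 'rV[R]_d) (t : R) :
  flow_inverse T u0 Y -> T t ->
  differentiable (fun p : 'rV[R]_d * R => Y p.1 p.2) (x, t).
Proof.
move=> fY Tt.
pose F (p : 'rV[R]_d * R) := (p.1 + p.2 *: u0 p.1, p.2).
pose G (p : 'rV[R]_d * R) := (Y p.1 p.2, p.2).
set y := Y x t; set B := invmx (1%:M + t *: grad u0 y)^T.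
(* [L] is the inverse of [(h, s) |-> (h + t h A^T + s u0(y), s)], which is the
   differential of [F] at [(y, t)]. *)
pose L (p : 'rV[R]_d * R) := ((p.1 - p.2 *: u0 y) *m B, p.2).
have ll (a : R) (v w : 'rV[R]_d) (b c : R) :
    ((a *: v + w) - (a * b + c) *: u0 y) *m B
    = a *: ((v - b *: u0 y) *m B) + (w - c *: u0 y) *m B.
  rewrite scalemxAl -mulmxDl; congr (_ *m _).
  by rewrite scalerDl scalerBr scalerA opprD addrACA.
have linL : linear L.
  by move=> a p q; exact: (congr2 pair (ll a p.1 q.1 p.2 q.2) erefl).
pose LM := GRing.isLinear.Build _ _ _ _ _ linL.
pose Ll : {linear ('rV[R]_d * R)%type -> ('rV[R]_d * R)%type} := HB.pack L LM.
have cL : continuous Ll.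
  move=> p; have c1 : (fun q : 'rV[R]_d * R => q.1 - q.2 *: u0 y) @ p -->
      (p.1 - p.2 *: u0 y).
    apply: cvgB; first exact: cvg_fst.
    by apply: cvgZ; [exact: cvg_snd|exact: cvg_cst].
  have c2 : (fun q : 'rV[R]_d * R => (q.1 - q.2 *: u0 y) *m B) @ p -->
      ((p.1 - p.2 *: u0 y) *m B).
    apply: cvg_mx_coord => i j; apply: cvg_mulmx => k l; last exact: cvg_cst.
    exact: coord_cvg c1.
  exact: (cvg_pair c2 cvg_snd).
have du0 : differentiable u0 y by exact: C1_differentiable (flow_C1 fY) _.
have du1 : is_diff (y, t) (u0 \o fst) ('d u0 y \o fst).
  by apply: is_diff_comp; [exact: is_diff_fst|exact: differentiableP].
have [dsc scE] := diff_scale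
  (@ex_diff _ _ _ _ _ _ _ (is_diff_snd (y, t))) (@ex_diff _ _ _ _ _ _ _ du1).
have dF : is_diff (y, t) F (fun h =>
    (h.1 + (t *: (h.1 *m (grad u0 y)^T) + h.2 *: u0 y), h.2)).
  apply: is_diff_pair; last exact: is_diff_snd.
  apply: is_diffD; first exact: is_diff_fst.
  apply: DiffDef; first exact: dsc.
  apply/funext => h; rewrite scE (@diff_val _ _ _ _ _ _ _ du1)/= diff_grad//.
  by rewrite (@diff_val _ _ _ _ _ _ _ (is_diff_snd (y, t))).
have dF' : differentiable F (y, t) by exact: ex_diff.
have dG : differentiable G (x, t).
  apply: (@differentiable_right_inverse _ _ _ F G (x, t) Ll cL dF').
  - move=> [h s]; rewrite (@diff_val _ _ _ _ _ _ _ dF)/= /L/=; congr pair.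
    rewrite addrA addrK scalemxAr -{1}[h]mulmx1 -mulmxDr -mulmxA.
    rewrite -trmx1 -linearZ -linearD /= mulmxV ?mulmx1// unitmx_tr.
    exact: flow_unit fY _ _ Tt.
  - have c1 : (fun p : 'rV[R]_d * R => Y p.1 p.2) @ (x, t) --> Y x t.
      exact: flow_continuous fY x t Tt.
    have c2 : (fun p : 'rV[R]_d * R => p.2) @ (x, t) --> t by exact: cvg_snd.
    exact: (cvg_pair c1 c2).
  - apply: filterS (near_time x (flow_open fY) Tt) => -[z s]/= Ts.
    by rewrite /F/= (flow_right_inverse fY).
exact: (differentiable_comp dG (@ex_diff _ _ _ _ _ _ _ (is_diff_fst _))).
Qed.

(** Differentiating [Y + s U = x] gives [dY = dx - ds U - t dU], to which the
    chain rule for [U = u0 o Y] applies the transposed gradient of [u0]. *)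
Lemma flow_field_diff (R : realType) d (T : set R) u0
    (Y : 'rV[R]_d -> R -> 'rV[R]_d) (x : 'rV[R]_d) (t : R) :
  flow_inverse T u0 Y -> T t ->
  let U (p : 'rV[R]_d * R) := u0 (Y p.1 p.2) in
  differentiable U (x, t) /\
  forall h s, 'd U (x, t) (h, s) =
    (h - s *: U (x, t) - t *: 'd U (x, t) (h, s)) *m (grad u0 (Y x t))^T.
Proof.
move=> fY Tt U; pose Yp (p : 'rV[R]_d * R) := Y p.1 p.2.
have dY : differentiable Yp (x, t) by exact: flow_differentiable fY Tt.
have du0 : differentiable u0 (Yp (x, t)).
  exact: C1_differentiable (flow_C1 fY) _.
have dU : differentiable U (x, t) by exact: (differentiable_comp dY du0).
split=> // h s.
have UE : 'd U (x, t) (h, s) = 'd Yp (x, t) (h, s) *m (grad u0 (Y x t))^T.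
  have e1 := congr1 (fun f => f (h, s)) (diff_comp dY du0).
  exact: etrans e1 (diff_grad ('d Yp (x, t) (h, s)) du0).
have is2 := @is_diff_snd R 'rV[R]_d R (x, t).
have is1 := @is_diff_fst R 'rV[R]_d R (x, t).
have d2 : differentiable (snd : 'rV[R]_d * R -> R) (x, t) by exact: ex_diff.
have d1 : differentiable (fst : 'rV[R]_d * R -> _) (x, t) by exact: ex_diff.
have [dsU sUE] := diff_scale d2 dU.
(* The identity [Y + s U = x] holds near [(x, t)] only, so it is differentiated
   through directional derivatives, which depend on germs. *)
have near_id : \forall p \near (x, t), (Yp + (fun p => p.2 *: U p)) p = p.1.
  apply: filterS (near_time x (flow_open fY) Tt) => -[z r]/= Tr.
  exact: flow_right_inverse fY z r Tr.
pose Z (p : 'rV[R]_d * R) := p.2 *: U p.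
have E := near_eq_derive (h, s) near_id.
have dsum := differentiableD dY dsU.
have a1 := congr1 (fun f => f (h, s)) (diffD dY dsU).
have a2 := congr1 (fun f => f (h, s)) (@diff_val _ _ _ _ _ _ _ is1).
have a3 := congr1 (fun f => f (h, s)) (@diff_val _ _ _ _ _ _ _ is2).
have E1 := etrans (esym a1) (etrans (esym (deriveE (h, s) dsum))
  (etrans E (etrans (deriveE (h, s) d1) a2))).
have a5 : t *: 'd U (x, t) (h, s) + s *: U (x, t) = 'd Z (x, t) (h, s) :=
  esym (etrans (sUE (h, s))
    (congr1 (fun r : R => t *: 'd U (x, t) (h, s) + r *: U (x, t)) a3)).
have E2 : 'd Yp (x, t) (h, s) + (t *: 'd U (x, t) (h, s) + s *: U (x, t)) = h
  := etrans (congr1 (fun v => 'd Yp (x, t) (h, s) + v) a5) E1.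
have sub3 (V : zmodType) (a b c e : V) : a + (b + c) = e -> a = e - c - b.
  by move=> <-; rewrite addrA !addrK.
exact: etrans UE
  (congr1 (fun v => v *m (grad u0 (Y x t))^T) (sub3 _ _ _ _ _ E2)).
Qed.

Lemma eq_mulmx_rV (F : fieldType) m n (B C : 'M[F]_(m, n)) :
  (forall h : 'rV_m, h *m B = h *m C) -> B = C.
Proof. by move=> BC; apply/row_matrixP => i; rewrite !rowE. Qed.

(** This is [flow_field_diff] in the space directions: the gradient of the
    solution is [(1 + t A)^-1 A] with [A] the gradient of the datum at the foot
    of the characteristic. *)
Lemma flow_grad (R : realType) d (T : set R) u0
    (Y : 'rV[R]_d -> R -> 'rV[R]_d) (x : 'rV[R]_d) (t : R) :
  flow_inverse T u0 Y -> T t ->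
  let A := grad u0 (Y x t) in let G := grad (fun y => u0 (Y y t)) x in
  G = A - t *: (A *m G).
Proof.
move=> fY Tt A G; have [dU dUE] := flow_field_diff x fY Tt.
have [slice _] := @diff_slices _ _ (fun y s => u0 (Y y s)) x t dU.
apply: trmx_inj; apply: eq_mulmx_rV => h.
have E := etrans (esym (slice h)) (dUE h 0).
have E1 := etrans E
  (congr1 (fun v => (h - 0 *: u0 (Y x t) - t *: v) *m A^T) (slice h)).
have -> : (A - t *: (A *m G))^T = A^T - t *: (G^T *m A^T).
  by rewrite -trmx_mul; apply/matrixP => i j; rewrite !mxE.
rewrite [LHS]E1 scale0r subr0 mulmxBl mulmxBr.
by rewrite -scalemxAl -scalemxAr mulmxA.
Qed.

(** In the direction [(u, 1)] of the characteristic, [flow_field_diff] reads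
    [w = - t w A^T], and [1 + t A] is invertible. *)
Lemma flow_material_derivative (R : realType) d (T : set R) u0
    (Y : 'rV[R]_d -> R -> 'rV[R]_d) (x : 'rV[R]_d) (t : R) :
  flow_inverse T u0 Y -> T t ->
  'd (fun p : 'rV[R]_d * R => u0 (Y p.1 p.2)) (x, t) (u0 (Y x t), 1) = 0.
Proof.
move=> fY Tt; have [dU dUE] := flow_field_diff x fY Tt.
have := dUE (u0 (Y x t)) 1; set w := 'd _ _ _.
rewrite scale1r subrr sub0r mulNmx => /eqP; rewrite eq_sym eqr_oppLR => /eqP wE.
have : w *m (1%:M + t *: grad u0 (Y x t))^T = 0.
  rewrite linearD/= trmx1 mulmxDr mulmx1 linearZ/= -scalemxAr scalemxAl.
  by rewrite wE subrr.
have u : (1%:M + t *: grad u0 (Y x t))^T \in unitmx.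
  by rewrite unitmx_tr; exact: flow_unit fY _ _ Tt.
by move=> wB0; rewrite -[w]mulmx1 -(mulmxV u) mulmxA wB0 mul0mx.
Qed.

(** For a field that is differentiable in space-time, the left-hand side of the
    Burgers equation is the derivative in the direction [(v, 1)]. *)
Lemma burgers_material (R : realType) d (v : 'rV[R]_d -> R -> 'rV[R]_d)
    (x : 'rV[R]_d) (t : R) :
  let V (p : 'rV[R]_d * R) := v p.1 p.2 in
  differentiable V (x, t) -> forall i,
  derive1 (v x) t 0 i + \sum_(j < d) v x t 0 j * grad (v ^~ t) x i j
  = 'd V (x, t) (v x t, 1) 0 i.
Proof.
move=> V dV i; have [slice dt] := diff_slices dV.
have -> : (v x t, 1) = (v x t, 0) + (0, 1) :> 'rV[R]_d * R.
  by apply: (congr2 pair); rewrite (addr0, add0r).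
have -> := linearD ('d V (x, t)) (v x t, 0) (0, 1).
have -> := slice (v x t); have -> := dt.
rewrite mxE addrC; congr (_ + _); rewrite mxE; apply: eq_bigr => j _.
by congr (_ * _); rewrite [RHS]mxE.
Qed.

(** * Uniqueness for linear differential equations *)

Lemma is_derive_coord (R : realType) d (w : R -> 'rV[R]_d) (s : R)
    (dw : 'rV[R]_d) i :
  is_derive s 1 w dw -> is_derive s 1 (fun r => w r 0 i) (dw 0 i).
Proof.
move=> [dws <-]; apply: DeriveDef; first exact: (derivable_mxP _ _ _).1.
by rewrite derive_mx// mxE.
Qed.

(** Use [2 |v_i v_j| <= v_i^2 + v_j^2] term by term. *)
Lemma quadratic_form_bound (R : realType) d (v : 'rV[R]_d) (B : 'M[R]_d)
    (K : R) :
  (forall i j, `|B i j| <= K) ->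
  `|\sum_i v 0 i * (v *m B) 0 i| <= K * d%:R * \sum_i (v 0 i) ^+ 2.
Proof.
move=> BK; set f := \sum_i (v 0 i) ^+ 2.
have termE i : `|v 0 i * (v *m B) 0 i|
    <= \sum_j K / 2 * ((v 0 i) ^+ 2 + (v 0 j) ^+ 2).
  rewrite mxE mulr_sumr; apply: le_trans (ler_norm_sum _ _ _) _.
  apply: ler_sum => j _; rewrite mulrA normrM normrM mulrC.
  apply: (@le_trans _ _ (K * (`|v 0 i| * `|v 0 j|))).
    by rewrite ler_wpM2r// mulr_ge0.
  have K0 : 0 <= K := le_trans (normr_ge0 _) (BK j i).
  rewrite -mulrA ler_wpM2l// -(real_normK (num_real (v 0 i)))
    -(real_normK (num_real (v 0 j))).
  by have := sqr_ge0 (`|v 0 i| - `|v 0 j|); lra.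
apply: le_trans (ler_norm_sum _ _ _) _.
apply: le_trans (ler_sum _ (fun i _ => termE i)) _.
under eq_bigr => i _ do rewrite -mulr_sumr big_split/= sumr_const card_ord.
rewrite -mulr_sumr big_split/= sumr_const card_ord sumrMnl -/f -mulr_natl.
by rewrite le_eqVlt; apply/orP; left; apply/eqP; field.
Qed.

(** Gronwall, backwards in time: with [f] the sum of the squares of the
    coordinates of [w] and [C] large enough, [f(s) exp(C s)] is nonnegative and
    nondecreasing, and it vanishes at [b]. *)
Lemma linear_ode_zero (R : realType) d (w : R -> 'rV[R]_d) (B : R -> 'M[R]_d)
    (a b : R) : a <= b ->
  (forall s, s \in `[a, b] -> is_derive s 1 w (w s *m B s)) ->
  (forall s, s \in `[a, b] -> {for s, continuous B}) ->
  w b = 0 -> w a = 0.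
Proof.
move=> ab dw cB wb0.
(* [K] bounds the entries of [B] on the compact interval. *)
have cN : {within `[a, b], continuous (fun s => `|B s|)}.
  apply: continuous_in_subspaceT => s; rewrite inE/= => sab.
  exact: cvg_norm (cB s sab).
have [c _ Bc] := EVT_max ab cN; set K := `|B c| in Bc.
have BK s i j : s \in `[a, b] -> `|B s i j| <= K.
  move=> sab; apply: le_trans (Bc s sab).
  rewrite [leRHS]/Num.Def.normr/= mx_normrE.
  exact: (le_bigmax _ (fun ij : 'I_d * 'I_d => `|B s ij.1 ij.2|) (i, j)).
pose f s := \sum_i (w s 0 i) ^+ 2; pose C := 2 * (K * d%:R).
pose f' s := \sum_i 2 * (w s 0 i * (w s *m B s) 0 i).
have df s : s \in `[a, b] -> is_derive s 1 f (f' s).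
  move=> sab; rewrite /f.
  have -> : (fun s => \sum_i (w s 0 i) ^+ 2) = \sum_i ((fun s => w s 0 i) ^+ 2).
    by apply/funext => r; rewrite fct_sumE.
  apply: is_derive_sum => i; have dwi := is_derive_coord i (dw s sab).
  apply: is_derive_eq.
  by rewrite -[LHS]/(2 * w s 0 i ^+ 1 * (w s *m B s) 0 i) expr1 mulrA.
pose g s := f s * expR (C * s).
pose g' s := expR (C * s) * (f' s + C * f s).
have dg s : s \in `[a, b] -> is_derive s 1 g (g' s).
  move=> sab; have dfs := df s sab.
  have de : is_derive s 1 (fun r => expR (C * r)) (C * expR (C * s)).
    apply: is_derive_eq.
    by rewrite -[LHS]/(expR (C * s) * (C * 1)) mulr1 mulrC.
  apply: is_derive_eq; rewrite /g'.
  rewrite -[LHS]/(f s * (C * expR (C * s)) + expR (C * s) * f' s); ring.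
have g'0 s : s \in `[a, b] -> 0 <= g' s.
  move=> sab; rewrite mulr_ge0 ?expR_ge0//.
  have := quadratic_form_bound (w s) (fun i j => BK s i j sab).
  rewrite -/(f s) /f' -mulr_sumr => /ler_normlP[le1 _].
  by rewrite /C; move: le1; lra.
have sub s : s \in `]a, b[ -> s \in `[a, b] by exact: subset_itv_oo_cc.
have ga : g a <= g b.
  apply: (@ger0_derive1_le_cc _ g a b) => //; rewrite ?bound_itvE//.
  - by move=> s /sub /dg [].
  - move=> s /sub sab; rewrite derive1E.
    by rewrite (@derive_val _ _ _ _ _ _ _ (dg s sab)) g'0.
  - apply: continuous_in_subspaceT => s; rewrite inE/= => sab.
    apply: differentiable_continuous; apply/derivable1_diffP.
    by have [] := dg s sab.
have gb : g b = 0.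
  by rewrite /g /f wb0 big1 ?mul0r// => i _; rewrite mxE expr0n.
have fa : f a = 0.
  apply/eqP; rewrite eq_le sumr_ge0 ?andbT; last by move=> i _; exact: sqr_ge0.
  by rewrite -(pmulr_lle0 _ (expR_gt0 (C * a))) -gb.
apply/rowP => i; rewrite mxE; apply/eqP; rewrite -sqrf_eq0.
have := psumr_eq0P (fun i _ => sqr_ge0 (w a 0 i)) fa => /(_ i isT) ->.
by [].
Qed.

(** * Existence and uniqueness of Burgers solutions *)

(** Let [c = v(x, t)] and follow [v] along the line
    [g(s) = (x + (s - t) c, s)]. As [v] solves the Burgers equation, the
    derivative of [w = v(g) - c] is [dv (c, 1) = dv (v, 1) + dv (- w, 0)], which
    is [- (w . grad) v]. This linear equation with [w(t) = 0] gives [w = 0] on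
    [(0, t]], and the continuity of [v] up to the initial time carries the
    conclusion to [s = 0]. *)
Lemma burgers_foot (R : realType) d M (I : set R) (u0 : 'rV[R]_d -> 'rV[R]_d)
    (v : 'rV[R]_d -> R -> 'rV[R]_d) (x : 'rV[R]_d) (t : R) :
  (forall s r : R, I r -> 0 <= s <= r -> I s) ->
  burgers_solution M I u0 v -> I t -> 0 <= t ->
  u0 (x - t *: v x t) = v x t.
Proof.
move=> Idown vsol It; rewrite le_eqVlt => /predU1P[<-|t0].
  by rewrite scale0r subr0 (burgers_initial vsol).
set c := v x t; pose g (s : R) : 'rV[R]_d * R := (x + (s - t) *: c, s).
pose V (p : 'rV[R]_d * R) := v p.1 p.2.
pose w s := V (g s) - c.
pose B s := - (grad (v ^~ s) (g s).1)^T.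
have dg (s : R) : is_diff s g (fun k => (k *: c, k)).
  apply: is_diff_pair.
  have -> : (fun s => x + (s - t) *: c) = cst (x - t *: c) + ( *:%R^~ c).
    by apply/funext => r; rewrite /cst/= scalerBl addrA addrAC.
  have := is_diffD (is_diff_cst (x - t *: c) s) (is_diff_scalel s c).
  by rewrite add0r.
have cg s : {for s, continuous g}.
  by apply: differentiable_continuous; have [] := dg s.
have It' (s : R) : 0 < s -> s <= t -> I s.
  by move=> s0 st; apply: (Idown _ t); rewrite // ltW.
have dw (s : R) : 0 < s -> s <= t -> is_derive s 1 w (w s *m B s).
  move=> s0 st; have Is := It' s s0 st.
  have dV : differentiable V (g s).
    exact: burgers_differentiable vsol _ _ Is s0.
  have dVg : is_diff s (V \o g) ('d V (g s) \o (fun k => (k *: c, k))).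
    exact: is_diff_comp (dg s) (differentiableP dV).
  have dVc : is_derive s 1 (V \o g) ('d V (g s) (1 *: c, 1)).
    have dd : differentiable (V \o g) s by exact: ex_diff.
    apply: DeriveDef; first exact: diff_derivable.
    by rewrite deriveE// (@diff_val _ _ _ _ _ _ _ dVg).
  have dwE : is_derive s 1 w ('d V (g s) (1 *: c, 1) - 0).
    exact: (is_deriveB dVc (is_derive_cst c s 1)).
  apply: is_derive_eq dwE _.
  have E0 : 'd V (g s) (v (g s).1 s, 1) = 0.
    apply/rowP => i; rewrite mxE -(burgers_material dV i).
    exact: burgers_equation vsol _ _ Is s0 i.
  have [slice _] := diff_slices dV.
  have -> : (1 *: c, 1) = (v (g s).1 s, 1) + (- w s, 0) :> 'rV[R]_d * R.
    apply: (congr2 pair); last by rewrite /= addr0.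
    by rewrite /= scale1r opprB addrC subrK.
  have -> := linearD ('d V (g s)) (v (g s).1 s, 1) (- w s, 0).
  rewrite E0; have -> := slice (- w s).
  by rewrite subr0 add0r mulNmx mulmxN.
have w0 (s : R) : 0 < s -> s <= t -> w s = 0.
  move=> s0 st; apply: (@linear_ode_zero _ _ w B s t st).
  - by move=> r /[!in_itv]/= /andP[sr rt]; apply: dw => //; exact: lt_le_trans sr.
  - move=> r /[!in_itv]/= /andP[sr rt]; have r0 := lt_le_trans s0 sr.
    have cG :=
      @burgers_continuous_grad _ _ _ _ _ _ vsol (g r).1 r (It' r r0 rt) r0.
    have cGg : (fun s => grad (v ^~ s) (g s).1) @ r --> grad (v ^~ r) (g r).1.
      exact: (@cvg_comp _ _ _ g (fun p : 'rV[R]_d * R => grad (v ^~ p.2) p.1)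
        _ _ _ (cg r) cG).
    apply: cvgN; apply: cvg_mx_coord => i j; rewrite mxE.
    under eq_fun do rewrite mxE; exact: coord_cvg cGg.
  - by rewrite /w /V /g /= subrr scale0r addr0 subrr.
have cV : V @ within [set p | I p.2] (nbhs (g 0)) --> V (g 0).
  have [+ _] := subspace_continuousP [set p : 'rV[R]_d * R | I p.2] V.
  move=> /(_ (burgers_continuous vsol)); apply => /=.
  by apply: (Idown _ t) => //; rewrite lexx ltW.
(* At time [0] the solution is continuous within the slab of times of [I], which
   the line approaches from above. *)
have cgr : g @ 0^'+ --> g 0 := cvg_at_right_filter (cg 0).
have cg0 : g @ 0^'+ --> within [set p | I p.2] (nbhs (g 0)).
  move=> P /cgr nPg.
  have {}nPg : \forall s \near 0^'+, I (g s).2 -> P (g s) := nPg.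
  suff : \forall s \near 0^'+, P (g s) by [].
  near=> s.
  have : I (g s).2 -> P (g s) by near: s.
  apply; apply: It'; first by near: s; exact: nbhs_right_gt.
  by near: s; exact: nbhs_right_le.
have lim1 : V \o g @ 0^'+ --> V (g 0) by exact: cvg_comp cg0 cV.
have lim2 : V \o g @ 0^'+ --> c.
  apply: cvg_near_cst; near=> s; apply/eqP; rewrite -subr_eq0; apply/eqP/w0.
    by near: s; exact: nbhs_right_gt.
  by near: s; exact: nbhs_right_le.
have PF : ProperFilter ((V \o g) @ 0^'+) by exact: fmap_proper_filter.
have /(_ PF) := cvg_unique (@norm_hausdorff _ _) lim1 lim2.
by rewrite /V /g /= (burgers_initial vsol) sub0r scaleNr.
Unshelve. all: by end_near. Qed.

(** Existence: the regularity and the equation come from [flow_field_diff], and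
    the gradient is continuous because it is [(1 + t A)^-1 A] with [A]
    continuous. Uniqueness: by [burgers_foot] any solution takes at [(x, t)] the
    value of [u0] at a point whose characteristic passes through [x] at time
    [t], and [Y x t] is the only such point. *)
Lemma flow_solution (R : realType) d M (I T : set R) (u0 : 'rV[R]_d -> 'rV[R]_d)
    (Y : 'rV[R]_d -> R -> 'rV[R]_d) :
  flow_inverse T u0 Y -> lives_on M u0 -> I `<=` T -> I 0 ->
  (forall t, I t -> 0 <= t) -> (forall s t, I t -> 0 <= s <= t -> I s) ->
  is_the_burgers_solution M I u0 (fun x t => u0 (Y x t)).
Proof.
move=> fY Mu0 IT I0 Ige Idown.
pose U (p : 'rV[R]_d * R) := u0 (Y p.1 p.2).
have dU (x : 'rV[R]_d) (t : R) : T t -> differentiable U (x, t).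
  by move=> Tt; have [] := flow_field_diff x fY Tt.
have cU (x : 'rV[R]_d) (t : R) : T t -> {for (x, t), continuous U}.
  by move=> Tt; exact: differentiable_continuous (dU x t Tt).
have cA (x : 'rV[R]_d) (t : R) i j : T t ->
    (fun p : 'rV[R]_d * R => grad u0 (Y p.1 p.2) i j) @ (x, t)
      --> grad u0 (Y x t) i j.
  move=> Tt.
  have cY : (fun p : 'rV[R]_d * R => Y p.1 p.2) @ (x, t) --> Y x t.
    exact: flow_continuous fY x t Tt.
  have cAy : (fun y => grad u0 y i j) @ Y x t --> grad u0 (Y x t) i j.
    by have := C1_grad_continuous (i := i) (j := j) (flow_C1 fY); exact.
  exact: (@cvg_comp _ _ _ (fun p : 'rV[R]_d * R => Y p.1 p.2)
    (fun y => grad u0 y i j) _ _ _ cY cAy).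
pose G (p : 'rV[R]_d * R) := grad (fun y => u0 (Y y p.2)) p.1.
have GE (p : 'rV[R]_d * R) : T p.2 -> G p =
    invmx (1%:M + p.2 *: grad u0 (Y p.1 p.2)) *m grad u0 (Y p.1 p.2).
  move=> Tp; have := @flow_grad _ _ _ _ _ p.1 p.2 fY Tp.
  rewrite /= -/(G p); set A := grad u0 _ => E.
  have u := flow_unit fY (Y p.1 p.2) Tp.
  apply: (can_inj (mulKmx u)); rewrite mulKVmx// mulmxDl mul1mx -scalemxAl.
  by rewrite {1}E subrK.
have cG (x : 'rV[R]_d) (t : R) : T t -> {for (x, t), continuous G}.
  move=> Tt; rewrite /prop_for /continuous_at GE//=.
  apply: (@cvg_trans _ ((fun p : 'rV[R]_d * R =>
      invmx (1%:M + p.2 *: grad u0 (Y p.1 p.2)) *m grad u0 (Y p.1 p.2))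
      @ (x, t))).
    apply: near_eq_cvg.
    by apply: filterS (near_time x (flow_open fY) Tt) => p Tp; rewrite GE.
  apply: (@cvg_mx_coord R _ (nbhs (x, t)) d d) => i j.
  apply: cvg_mulmx => k l; last exact: cA.
  apply: cvg_invmx => [|m n]; first exact: flow_unit fY _ _ Tt.
  under eq_fun do rewrite mxE [X in _ + X]mxE; rewrite mxE [X in _ + X]mxE.
  apply: cvgD; first exact: cvg_cst.
  by apply: cvgM; [exact: cvg_snd|exact: cA].
have eqn (x : 'rV[R]_d) (t : R) : T t -> forall i,
    derive1 (fun t => u0 (Y x t)) t 0 i +
      \sum_(j < d) u0 (Y x t) 0 j * G (x, t) i j = 0.
  move=> Tt i.
  rewrite (@burgers_material _ _ (fun y s => u0 (Y y s)) x t (dU x t Tt) i).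
  by rewrite (flow_material_derivative x fY Tt) mxE.
split=> [|v vsol x t It]; last first.
  have foot := burgers_foot x Idown vsol It (Ige t It).
  rewrite -foot /=; congr (u0 _); apply: (flow_unique fY (IT t It)).
  by rewrite foot subrK.
split=> //.
- move=> t It; case: M Mu0 => // Mu0 j x /=.
  suff -> : Y (x + delta_mx 0 j) t = Y x t + delta_mx 0 j by rewrite Mu0.
  apply/esym; apply: (flow_unique fY (IT t It)).
  by rewrite Mu0 addrAC (flow_right_inverse fY)//; exact: IT.
- by apply: continuous_in_subspaceT => -[x t]; rewrite inE/= => /IT; exact: cU.
- by move=> x t /IT Tt _; exact: dU.
- by move=> x t /IT Tt _; exact: cG.
- move=> x t /IT Tt _; rewrite /prop_for /continuous_at /=.
  have dtE (p : 'rV[R]_d * R) : T p.2 ->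
      derive1 (fun t => u0 (Y p.1 t)) p.2 = - (U p *m (G p)^T).
    case: p => [y s] Ts; apply/rowP => i.
    rewrite mxE mxE; apply/eqP; rewrite -addr_eq0 -[X in _ == X](eqn y s Ts i).
    apply/eqP; congr (_ + _); apply: eq_bigr => j _.
    by congr (_ * _); rewrite mxE.
  have := dtE (x, t) Tt; rewrite /= => ->.
  apply: (@cvg_trans _ ((fun p => - (U p *m (G p)^T)) @ (x, t))).
    apply: near_eq_cvg.
    by apply: filterS (near_time x (flow_open fY) Tt) => p Tp; rewrite -dtE.
  have c : (fun p => U p *m (G p)^T) @ (x, t) --> U (x, t) *m (G (x, t))^T.
    apply: cvg_mx_coord => i j; apply: cvg_mulmx => k l.
      exact: coord_cvg (cU x t Tt).
    by under eq_fun do rewrite mxE; rewrite mxE; exact: coord_cvg (cG x t Tt).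
  exact: cvgN c.
- by move=> x t /IT Tt _; exact: eqn.
- move=> x; have := flow_right_inverse fY x (IT 0 I0).
  by rewrite scale0r addr0 => ->.
Qed.

(** * Small times: feet of characteristics by contraction *)

(** Joins the completeness and the norm of matrices, as Banach's theorem is
    stated for complete normed modules. *)
HB.instance Definition _ (R : realType) (m n : nat) :=
  Uniform_isComplete.Build 'M[R]_(m, n) (@mx_complete R m n).

Lemma rowsum_le_Linf (R : realType) d (A : 'rV[R]_d -> 'M[R]_d) x :
  ((rowsum_norm (A x))%:E <= Linf_norm A)%E.
Proof. by apply: ereal_sup_ubound; exists x. Qed.

Lemma Linf_norm_le (R : realType) d (A : 'rV[R]_d -> 'M[R]_d) e :
  (forall x, rowsum_norm (A x) <= e) -> (Linf_norm A <= e%:E)%E.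
Proof. by move=> Ae; apply: ge_ereal_sup => _ [x _ <-]; rewrite lee_fin. Qed.

(** Mean value theorem on each component along the segment from [x] to [y]. *)
Lemma lipschitz_of_grad (R : realType) d (u : 'rV[R]_d -> 'rV[R]_d) (N : R) :
  (forall x, differentiable u x) -> (forall x, rowsum_norm (grad u x) <= N) ->
  forall x y, `|u y - u x| <= N * `|y - x|.
Proof.
move=> du uN x y.
have N0 : 0 <= N by apply: le_trans (uN x); exact: rowsum_norm_ge0.
apply: norm_le_coord => [|i]; first by rewrite mulr_ge0.
pose g (s : R) := x + s *: (y - x).
have dg (s : R) : is_diff s g ( *:%R ^~ (y - x)).
  have -> : g = cst x + ( *:%R^~ (y - x)) by apply/funext.
  have := is_diffD (is_diff_cst x s) (is_diff_scalel s (y - x)).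
  by rewrite add0r.
pose f (s : R) := u (g s) 0 i.
have df (s : R) : is_derive s 1 f (((y - x) *m (grad u (g s))^T) 0 i).
  have dug : is_diff s (u \o g) ('d u (g s) \o ( *:%R ^~ (y - x))).
    exact: is_diff_comp (dg s) (differentiableP (du (g s))).
  have dd : differentiable (u \o g) s by exact: ex_diff.
  have -> : (y - x) *m (grad u (g s))^T = 'D_(1 : R) (u \o g) s.
    rewrite (deriveE (1 : R) dd) (@diff_val _ _ _ _ _ _ _ dug) /= scale1r.
    by rewrite (diff_grad _ (du (g s))).
  apply: (@is_derive_coord R d (u \o g) s).
  by apply: DeriveDef => //; exact: diff_derivable.
have cf : {within `[0, 1], continuous f}.
  apply: continuous_in_subspaceT => s _.
  by apply: differentiable_continuous; apply/derivable1_diffP; have [] := df s.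
have [c _] := MVT_segment (@ler01 R) (fun s _ => df s) cf.
rewrite subr0 mulr1 /f /g scale1r scale0r addr0 subrKC !mxE => ->.
have := coord_le_norm ((y - x) *m (grad u (g c))^T) i.
rewrite mxE => /le_trans; apply.
by apply: le_trans (norm_mul_tr _ _) _; rewrite ler_wpM2r.
Qed.

(** Subtract the two characteristics and absorb [t (u(y) - u(y'))] in the
    left-hand side by the Lipschitz bound. For [|t| N < 1] this controls how far
    the foot moves when [x] and [t] do, which gives both injectivity and
    continuity. *)
Lemma foot_dist (R : realType) d (u : 'rV[R]_d -> 'rV[R]_d) (N : R) :
  (forall x y, `|u y - u x| <= N * `|y - x|) ->
  forall t t' y y', (1 - `|t| * N) * `|y - y'| <=
    `|(y + t *: u y) - (y' + t' *: u y')| + `|t - t'| * `|u y'|.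
Proof.
move=> uN t t' y y'.
set x := y + t *: u y; set x' := y' + t' *: u y'.
have E : y - y' = (x - x') - t *: (u y - u y') - (t - t') *: u y'.
  by apply/rowP => i; rewrite /x /x' !mxE; ring.
have : `|y - y'| <= `|x - x'| + `|t| * (N * `|y - y'|) + `|t - t'| * `|u y'|.
  rewrite {1}E -[`|t - t'| * _]normrZ.
  apply: le_trans (ler_normB _ _) (lerD _ (lexx _)).
  apply: le_trans (ler_normB _ _) (lerD (lexx _) _).
  by rewrite normrZ ler_wpM2l.
by lra.
Qed.

(** A foot is a fixed point of [y |-> x - t u(y)], a contraction. *)
Lemma foot_exists (R : realType) d (u : 'rV[R]_d -> 'rV[R]_d) (N t : R) x :
  0 <= N -> (forall x y, `|u y - u x| <= N * `|y - x|) -> `|t| * N < 1 ->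
  exists y, y + t *: u y = x.
Proof.
move=> N0 uN tN.
pose f y := x - t *: u y.
pose fF := isFun.Build _ _ [set: 'rV[R]_d] [set: 'rV[R]_d] f (fun _ _ => I).
pose F : {fun [set: 'rV[R]_d] >-> [set: 'rV[R]_d]} := HB.pack f fF.
have tN0 : 0 <= `|t| * N by rewrite mulr_ge0.
have ctr : is_contraction F.
  exists (NngNum tN0); split => //= -[y z] _ /=.
  have -> : f y - f z = t *: (u z - u y).
    by apply/rowP => i; rewrite /f !mxE; ring.
  by rewrite normrZ -mulrA ler_wpM2l// (distrC y z).
have [y _ yE] := banach_fixed_point ctr closedT (ex_intro _ 0 I).
by exists y; rewrite {1}yE /= /f subrK.
Qed.

Lemma foot_unique (R : realType) d (u : 'rV[R]_d -> 'rV[R]_d) (N t : R) :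
  (forall x y, `|u y - u x| <= N * `|y - x|) -> `|t| * N < 1 ->
  injective (fun y => y + t *: u y).
Proof.
move=> uN tN y y' E; have := foot_dist uN t t y y'.
rewrite E !subrr !normr0 mul0r addr0 pmulr_rle0 ?subr_gt0// normr_le0.
by rewrite subr_eq0 => /eqP.
Qed.

Definition foot (R : realType) d (u : 'rV[R]_d -> 'rV[R]_d) x t :=
  xget 0 [set y | y + t *: u y = x].

Lemma flow_inverse_foot (R : realType) d (u : 'rV[R]_d -> 'rV[R]_d) (N : R) :
  (forall i, Ck 1 (fun x => u x 0 i)) ->
  (forall x, rowsum_norm (grad u x) <= N) ->
  flow_inverse [set t | `|t| * N < 1] u (foot u).
Proof.
move=> C1 uN.
have N0 : 0 <= N by apply: le_trans (uN 0); exact: rowsum_norm_ge0.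
have lip := lipschitz_of_grad (C1_differentiable C1) uN.
have footE x t : `|t| * N < 1 -> foot u x t + t *: u (foot u x t) = x.
  move=> tN; exact: (xgetPex 0 (foot_exists x N0 lip tN)).
have oT : open [set t : R | `|t| * N < 1].
  apply: (@open_comp _ _ (fun t : R => `|t| * N) [set t | t < 1]).
    move=> t _; apply: cvgM; last exact: cvg_cst.
    by apply: cvg_norm; exact: cvg_id.
  exact: open_lt.
split=> //.
- by move=> x y t tN yE; apply: (foot_unique lip tN); rewrite /= yE footE.
- move=> x t tN.
  (* [b] is the bound of [foot_dist] solved for the displacement of the foot. *)
  pose b (p : 'rV[R]_d * R) :=
    (`|p.1 - x| + `|p.2 - t| * `|u (foot u x t)|) * (1 - `|p.2| * N)^-1.
  have b0 : b @ (x, t) --> 0.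
    rewrite -(mul0r (1 - `|t| * N)^-1); apply: cvgM.
      rewrite -(addr0 0); apply: cvgD.
        rewrite -(@normr0 _ 'rV[R]_d) -(subrr x).
        have c1 : (fun p : 'rV[R]_d * R => p.1 - x) @ (x, t) --> x - x.
          by apply: cvgB; [exact: cvg_fst|exact: cvg_cst].
        exact: cvg_norm c1.
      rewrite -(mul0r `|u (foot u x t)|); apply: cvgM; last exact: cvg_cst.
      rewrite -(@normr0 _ R) -(subrr t).
      have c2 : (fun p : 'rV[R]_d * R => p.2 - t) @ (x, t) --> t - t.
        by apply: cvgB; [exact: cvg_snd|exact: cvg_cst].
      exact: cvg_norm c2.
    apply: cvgV; first by rewrite gt_eqF// subr_gt0.
    apply: cvgB; first exact: cvg_cst.
    apply: cvgM; last exact: cvg_cst.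
    have c3 : (fun p : 'rV[R]_d * R => p.2) @ (x, t) --> t by exact: cvg_snd.
    exact: cvg_norm c3.
  have T_nbhs : \forall p \near (x, t), `|p.2| * N < 1.
    exact: (@near_time _ _ [set t | `|t| * N < 1]).
  rewrite /prop_for /continuous_at; apply/cvgrPdist_le => e e0.
  have be : \forall p \near (x, t), b p <= e.
    apply: filterS ((cvgrPdist_le _ _).1 b0 _ e0) => p.
    by rewrite sub0r normrN => /ler_normlW.
  near=> p; have pT : `|p.2| * N < 1 by near: p.
  rewrite distrC; apply: le_trans (_ : b p <= e); last by near: p.
  rewrite /b ler_pdivlMr ?subr_gt0// mulrC.
  by have := foot_dist lip p.2 t (foot u p.1 p.2) (foot u x t); rewrite !footE.
- move=> x t tN; apply: unitmx_small_perturbation.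
  by apply: le_lt_trans tN; rewrite ler_wpM2l.
Unshelve. all: by end_near. Qed.

(** * A periodic shear with nilpotent gradient *)

(** Keeping the phases [b] free makes this class of functions closed under
    partial derivatives, a derivative of a sine being a sine shifted by a quarter
    period; smoothness is then one induction ([wave_Ck]). *)
Definition wave (R : realType) d (a b : 'I_d -> R) (x : 'rV[R]_d) : R :=
  \sum_j a j * sin (2 * pi * x 0 j + b j).

Lemma diff_sine_coord (R : realType) d (b : R) (j : 'I_d) (x : 'rV[R]_d) :
  is_diff x (fun y : 'rV[R]_d => sin (2 * pi * y 0 j + b))
    (fun h => 2 * pi * h 0 j * cos (2 * pi * x 0 j + b)).
Proof.
have dc : is_diff x (fun y : 'rV[R]_d => y 0 j) (fun h => h 0 j).
  have di : differentiable (@idfun 'rV[R]_d) x by exact: ex_diff.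
  apply: DiffDef; first exact: (diff_coord j 0 di).1.
  apply/funext => h; rewrite (diff_coord j h di).2.
  by rewrite (@diff_val _ _ _ _ _ _ _ (is_diff_id x)).
have dl : is_diff x (fun y : 'rV[R]_d => 2 * pi * y 0 j + b)
    (fun h => 2 * pi * h 0 j).
  have := is_diffD (is_diffZ (2 * pi) dc) (is_diff_cst b x).
  by rewrite addr0.
have ds (r : R) : is_diff r sin (fun k => k * cos r).
  have dr : is_derive r 1 sin (cos r) by exact: is_derive_sin.
  apply: DiffDef; first by apply/derivable1_diffP; have [] := dr.
  rewrite diff1E; last by apply/derivable1_diffP; have [] := dr.
  by rewrite derive1E (@derive_val _ _ _ _ _ _ _ dr).
exact: is_diff_comp dl (ds _).
Qed.

Lemma partial_wave (R : realType) d (a b : 'I_d -> R) (x : 'rV[R]_d) m :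
  differentiable (wave a b) x /\
  partial m (wave a b) x = 2 * pi * a m * cos (2 * pi * x 0 m + b m).
Proof.
pose f j := a j *: (fun y : 'rV[R]_d => sin (2 * pi * y 0 j + b j)).
have fE : wave a b = \sum_j f j by apply/funext => y; rewrite fct_sumE.
have dsj j := diff_sine_coord (b j) j x.
have df j : differentiable (f j) x.
  by apply: differentiableZ; exact: (@ex_diff _ _ _ _ _ _ _ (dsj j)).
split; first by rewrite fE; exact: differentiable_sum.
rewrite /partial fE derive_sum; last by move=> j; exact: diff_derivable.
rewrite (bigD1 m)//= big1 => [|j jm].
  rewrite addr0 (deriveE _ (df m)) diffZ; last first.
    exact: (@ex_diff _ _ _ _ _ _ _ (dsj m)).
  rewrite (@diff_val _ _ _ _ _ _ _ (dsj m)) /= mxE !eqxx mulr1.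
  by rewrite -[LHS]/(a m * _) mulrA (mulrC (a m)).
rewrite (deriveE _ (df j)) diffZ; last first.
  exact: (@ex_diff _ _ _ _ _ _ _ (dsj j)).
rewrite (@diff_val _ _ _ _ _ _ _ (dsj j)) /= mxE eqxx (negbTE jm) mulr0 mul0r.
by rewrite scaler0.
Qed.

Lemma wave_Ck (R : realType) d k (a b : 'I_d -> R) : Ck k (wave a b).
Proof.
have dw (a' b' : 'I_d -> R) (x : 'rV[R]_d) : differentiable (wave a' b') x.
  rewrite /wave.
  have -> : (fun x : 'rV[R]_d => \sum_j a' j * sin (2 * pi * x 0 j + b' j)) =
      \sum_j (a' j *: (fun y : 'rV[R]_d => sin (2 * pi * y 0 j + b' j))).
    by apply/funext => y; rewrite fct_sumE.
  apply: differentiable_sum => j; apply: differentiableZ.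
  exact: (@ex_diff _ _ _ _ _ _ _ (diff_sine_coord (b' j) j x)).
elim: k a b => [|k IH] a b /=.
  by move=> x; exact: differentiable_continuous.
split=> // m.
suff -> : partial m (wave a b) = wave
    (fun j => if j == m then 2 * pi * a j else 0) (fun j => b j + pi / 2) by [].
apply/funext => x; rewrite (partial_wave a b x m).2 /wave (bigD1 m)//= big1.
  by rewrite eqxx addr0 addrA sinDpihalf.
by move=> j /negbTE ->; rewrite mul0r.
Qed.

Lemma wave_periodic (R : realType) d (a b : 'I_d -> R) m :
  periodic (wave a b) (delta_mx 0 m).
Proof.
move=> x; apply: eq_bigr => j _; congr (_ * _); rewrite !mxE eqxx.
case: (j == m); last by rewrite addr0.
by rewrite mulrDr mulr1 addrAC !(mulr_natl pi 2) sinD2pi.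
Qed.

(** Component [i] is [sin(2 pi x_(i + 1) + pi) / (2 pi)], and [0] for the last
    one. The phase [pi] makes the superdiagonal entries of the gradient equal to
    [- 1] at the origin, so that all terms of the resolvent series there have the
    same sign. *)
Definition shear (R : realType) d (x : 'rV[R]_d) : 'rV[R]_d :=
  \row_i wave (fun j : 'I_d => (j == i.+1 :> nat)%:R / (2 * pi)) (fun=> pi) x.

Lemma grad_shear (R : realType) d (x : 'rV[R]_d) i j :
  grad (@shear R d) x i j
  = (j == i.+1 :> nat)%:R * cos (2 * pi * x 0 j + pi).
Proof.
rewrite mxE; under [in X in partial _ X]eq_fun do rewrite mxE.
rewrite (partial_wave _ _ x j).2; congr (_ * _).
by rewrite mulrCA divff ?mulr1// mulf_neq0// gt_eqF// pi_gt0.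
Qed.

Lemma shear_smooth (R : realType) d M : smooth_field M (@shear R d).
Proof.
split=> [|i k]; last first.
  have -> : (fun x => @shear R d x 0 i) = wave
    (fun j : 'I_d => (j == i.+1 :> nat)%:R / (2 * pi)) (fun=> pi).
    by apply/funext => x; rewrite mxE.
  exact: wave_Ck.
case: M => //= m x; apply/rowP => i; rewrite !mxE; exact: wave_periodic.
Qed.

Lemma sum_succ (R : realType) d (F : 'I_d -> R) (i : nat) :
  (forall lt_id : (i.+1 < d)%N,
    \sum_(j < d) (j == i.+1 :> nat)%:R * F j = F (Ordinal lt_id)) /\
  ((d <= i.+1)%N -> \sum_(j < d) (j == i.+1 :> nat)%:R * F j = 0).
Proof.
split=> [lt_id|le_di].
  rewrite (bigD1 (Ordinal lt_id))//= eqxx mul1r big1 ?addr0// => j.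
  by rewrite -val_eqE /= => /negbTE ->; rewrite mul0r.
rewrite big1// => j _; case: eqP => [E|]; last by rewrite mul0r.
by have := ltn_ord j; rewrite E ltnNge le_di.
Qed.

Lemma rowsum_grad_shear (R : realType) d (x : 'rV[R]_d) :
  rowsum_norm (grad (@shear R d) x) <= 1.
Proof.
apply: rowsum_norm_le => // i.
apply: (@le_trans _ _ (\sum_(j < d) (j == i.+1 :> nat)%:R * 1)).
  apply: ler_sum => j _; rewrite grad_shear normrM normr_nat ler_wpM2l//.
  by rewrite ler_norml cos_geN1 cos_le1.
have [s1 s2] := sum_succ (fun _ : 'I_d => 1 : R) i.
by have [le_di|lt_id] := leqP d i.+1; [rewrite s2// ler01|rewrite (s1 lt_id)].
Qed.

Lemma Linf_grad_shear (R : realType) d : (2 <= d)%N ->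
  Linf_norm (grad (@shear R d)) = 1%:E.
Proof.
case: d => [|d]// d2; apply/eqP; rewrite eq_le; apply/andP; split.
  by apply: Linf_norm_le; exact: rowsum_grad_shear.
apply: le_trans (rowsum_le_Linf (grad (@shear R d.+1)) 0); rewrite lee_fin.
apply: le_trans (row_le_rowsum (grad (@shear R d.+1) 0) ord0).
rewrite (bigD1 (Ordinal d2))//= grad_shear /= mxE mulr0 add0r cospi ?eqxx mul1r.
by rewrite normrN1 lerDl sumr_ge0.
Qed.

(** The [k]-th power is supported on the [k]-th superdiagonal. *)
Lemma grad_shear_nilpotent (R : realType) d (x : 'rV[R]_d) :
  nilpotent_mx (grad (@shear R d) x).
Proof.
set A := grad _ x; suff pow k (i j : 'I_d) : (j != i + k :> nat)%N -> (A ^+ k) i j = 0.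
  exists d; apply/matrixP => i j; rewrite pow ?[RHS]mxE// ltn_eqF//.
  exact: leq_trans (ltn_ord j) (leq_addl _ _).
elim: k i j => [|k IH] i j ij.
  by rewrite expr0 mxE -val_eqE /= eq_sym -{1}(addn0 i) (negbTE ij).
rewrite exprS -[_ * _]/(A *m A ^+ k) mxE big1// => l _.
rewrite grad_shear; case: eqP => [li|]; last by rewrite !mul0r.
by rewrite IH ?mulr0// li addSnnS.
Qed.

(** The matrix is upper triangular with ones on the diagonal. *)
Lemma shear_unit (R : realType) d (x : 'rV[R]_d) t :
  1%:M + t *: grad (@shear R d) x \in unitmx.
Proof.
rewrite unitmxE -det_tr det_trig; last first.
  apply/is_trig_mxP => i j ij.
  rewrite mxE mxE [X in _ + X]mxE grad_shear mxE.
  rewrite [i == j.+1 :> nat]ltn_eqF ?mul0r ?mulr0 ?addr0; last by rewrite ltnW.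
  by rewrite -val_eqE /= gtn_eqF.
rewrite big1 ?unitr1// => i _; rewrite mxE mxE [X in _ + X]mxE grad_shear mxE.
by rewrite eqxx ltn_eqF// mul0r mulr0 addr0.
Qed.

(** * The Burgers flow of the shear *)

Lemma shear_local (R : realType) d (y z : 'rV[R]_d) (i : 'I_d) :
  (forall j : 'I_d, (i < j)%N -> y 0 j = z 0 j) ->
  shear y 0 i = shear z 0 i.
Proof.
move=> yz; rewrite !mxE; apply: eq_bigr => j _.
have [ji|_] := eqVneq (j : nat) i.+1; last by rewrite !mul0r.
by rewrite yz// ji.
Qed.

Definition picard (R : realType) d (x : 'rV[R]_d) (t : R) (y : 'rV[R]_d) :=
  x - t *: shear y.

(** Each iteration makes one more coordinate, starting from the last, independent
    of the starting point, since component [i] of the shear only sees coordinate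
    [i + 1]. *)
Lemma picard_nilpotent (R : realType) d (x : 'rV[R]_d) t k y z (i : 'I_d) :
  (d <= i + k)%N -> iter k (picard x t) y 0 i = iter k (picard x t) z 0 i.
Proof.
elim: k i => [|k IH] i dik; first by move: dik; rewrite addn0 leqNgt ltn_ord.
rewrite !iterS /picard mxE [in RHS]mxE; congr (_ + _).
rewrite mxE [in RHS]mxE; congr (- _); rewrite mxE [in RHS]mxE; congr (_ * _).
apply: shear_local => j ij; apply: IH; apply: leq_trans dik _.
by rewrite -addSnnS leq_add2r.
Qed.

(** After [d] iterations the result is independent of the starting point; it is
    therefore the unique fixed point, whatever the size of [t]. *)
Lemma picardE (R : realType) d (x : 'rV[R]_d) t y :
  (y + t *: shear y = x) <-> (y = iter d (picard x t) 0).
Proof.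
have const y1 y2 : iter d (picard x t) y1 = iter d (picard x t) y2.
  by apply/rowP => i; apply: picard_nilpotent; rewrite leq_addl.
split=> [E|->].
  have fixy : picard x t y = y by rewrite /picard -E addrK.
  have fixk k : iter k (picard x t) y = y by elim: k => //= k ->.
  by rewrite (const 0 y) fixk.
set z := iter _ _ _.
have {1}-> : z = picard x t z by rewrite -[RHS]iterS iterSr; exact: const.
by rewrite /picard subrK.
Qed.

Lemma shear_flow_inverse (R : realType) d : flow_inverse (@setT R) (@shear R d)
  (fun x t => iter d (picard x t) 0).
Proof.
have [_ sm] := @shear_smooth R d Euclidean.
split.
- by move=> i; exact: sm.
- exact: openT.
- by move=> x t _; apply/picardE.
- by move=> x y t _ /picardE.
- have cs : continuous (@shear R d).
    move=> y; apply: differentiable_continuous; apply: C1_differentiable => i.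
    exact: sm.
  move=> x t _; rewrite /prop_for /continuous_at.
  suff cv k : (fun p : 'rV[R]_d * R => iter k (picard p.1 p.2) 0) @ (x, t)
      --> iter k (picard x t) 0 by exact: cv.
  elim: k => [|k IH] /=; first exact: cvg_cst.
  have c : (fun p : 'rV[R]_d * R => shear (iter k (picard p.1 p.2) 0)) @ (x, t)
      --> shear (iter k (picard x t) 0).
    exact: (@cvg_comp _ _ _ _ (@shear R d) _ _ _ IH (cs _)).
  apply: cvgB; first exact: cvg_fst.
  by apply: cvgZ; [exact: cvg_snd|exact: c].
- by move=> x t _; exact: shear_unit.
Qed.

Definition shear_flow (R : realType) d (x : 'rV[R]_d) (t : R) : 'rV[R]_d :=
  shear (iter d (picard x t) 0).

Lemma shear_solution (R : realType) M d : is_the_burgers_solution M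
  [set t : R | 0 <= t] (@shear R d) (@shear_flow R d).
Proof.
apply: (flow_solution (shear_flow_inverse R d)) => //=.
- by have [] := shear_smooth R d M.
- by move=> s t _ /andP[].
Qed.

Lemma Linf_shear_flow_le (R : realType) d (t : R) : 0 <= t -> t < 1 ->
  (Linf_norm (grad (@shear_flow R d ^~ t)) <= (1 / (1 - t))%:E)%E.
Proof.
move=> t0 t1; apply: Linf_norm_le => x.
have := @rowsum_norm_resolvent R d _ _ t 1 t0 _
  (rowsum_grad_shear _) (@flow_grad _ _ _ _ _ x t (shear_flow_inverse R d) I).
by rewrite mulr1; apply.
Qed.

(** The origin is a fixed foot, and there [A] is the opposite of the shift. The
    identity [G = A - t A G] becomes, for the row sums [s] of [G], the recursion
    [s_i = - (1 - t s_(i + 1))] starting from [0] in the last row, so the first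
    row sums to the opposite of a geometric sum. *)
Lemma Linf_shear_flow_ge (R : realType) d (t : R) : 0 <= t ->
  ((\sum_(m < d) t ^+ m)%:E <= Linf_norm (grad (@shear_flow R d.+1 ^~ t)))%E.
Proof.
move=> t0; apply: le_trans (rowsum_le_Linf _ (0 : 'rV[R]_d.+1)); rewrite lee_fin.
set G := grad _ _; set A := grad (@shear R d.+1) 0.
have foot0 : iter d.+1 (picard (0 : 'rV[R]_d.+1) t) 0 = 0.
  apply/esym/picardE; rewrite add0r (_ : shear 0 = 0) ?scaler0//.
  apply/rowP => i; rewrite !mxE /wave big1// => j _.
  by rewrite mxE mulr0 add0r sinpi mulr0.
have GE : G = A - t *: (A *m G).
  have := @flow_grad _ _ _ _ _ 0 t (shear_flow_inverse R d.+1) I.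
  by cbv zeta; rewrite foot0.
have AE i j : A i j = - (j == i.+1 :> nat)%:R.
  by rewrite /A grad_shear mxE mulr0 add0r cospi mulrN1.
clearbody A G.
pose s i := \sum_j G i j.
have sE i : s i = - \sum_(j < d.+1) (j == i.+1 :> nat)%:R * (1 - t * s j).
  have -> : s i = \sum_j A i j - t * \sum_j \sum_l A i l * G l j.
    rewrite /s {1}GE mulr_sumr -sumrB; apply: eq_bigr => j _.
    by rewrite !mxE.
  rewrite exchange_big mulr_sumr -sumrB -sumrN; apply: eq_bigr => j _.
  by rewrite -mulr_sumr -/(s j) AE; ring.
(* Induction from the last row upwards: row [i] is [k] steps before it. *)
have sk k (i : 'I_d.+1) : (i + k.+1 = d.+1)%N -> s i = - \sum_(m < k) t ^+ m.
  elim: k i => [|k IH] i ik.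
    rewrite sE (sum_succ (fun j => 1 - t * s j) i).2 ?big_ord0//.
    by move: ik; rewrite addn1 => ->.
  have lt_id : (i.+1 < d.+1)%N.
    have : (i.+1 < i + k.+2)%N by rewrite !addnS !ltnS leq_addr.
    by rewrite ik.
  rewrite sE ((sum_succ (fun j => 1 - t * s j) i).1 lt_id) IH; last first.
    by rewrite /= addSnnS.
  rewrite big_ord_recl expr0 mulrN opprK mulr_sumr.
  by under [in RHS]eq_bigr do rewrite exprS.
have := sk d ord0 erefl => s0.
apply: le_trans (row_le_rowsum _ ord0).
have <- : `|s ord0| = \sum_(m < d) t ^+ m.
  by rewrite s0 normrN ger0_norm// sumr_ge0// => m _; rewrite exprn_ge0.
exact: ler_norm_sum.
Qed.

(** For [t < 1], squeeze between the partial geometric sums and the general bound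
    [1 / (1 - t)]; at [t = 1] the geometric sum with [d] terms is [d]. *)
Lemma Linf_shear_flow_cvg (R : realType) (t : R) : 0 <= t <= 1 ->
  (fun d : nat => Linf_norm (grad (@shear_flow R d ^~ t))) @ \oo -->
    (if t == 1 then +oo%E else (1 / (1 - t))%:E).
Proof.
move=> /andP[t0 t1]; set l : \bar R := if _ then _ else _.
suff cl : (fun n => Linf_norm (grad (@shear_flow R n.+1 ^~ t))) @ \oo --> l.
  by rewrite -cvg_shiftS; exact: cl.
rewrite /l; case: eqVneq => [tE|tN1].
  have le : \forall n \near \oo,
      ((n%:R : R)%:E <= Linf_norm (grad (@shear_flow R n.+1 ^~ t)))%E.
    apply: nearW => n; apply: le_trans (Linf_shear_flow_ge n t0).
    rewrite lee_fin tE; under eq_bigr do rewrite expr1n.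
    by rewrite sumr_const card_ord.
  by apply: (gee_cvgy le); apply/cvgenyP; exact: cvg_id.
have {t1}t1 : t < 1 by rewrite lt_neqAle tN1.
have le : \forall n \near \oo,
    ((series (geometric 1 t) n)%:E <=
       Linf_norm (grad (@shear_flow R n.+1 ^~ t)) <= (1 / (1 - t))%:E)%E.
  apply: nearW => n; rewrite Linf_shear_flow_le// andbT.
  apply: le_trans (Linf_shear_flow_ge n t0).
  rewrite lee_fin; suff -> : series (geometric 1 t) n = \sum_(m < n) t ^+ m by [].
  by rewrite /series/= big_mkord; apply: eq_bigr => m _; rewrite /= mul1r.
apply: (@squeeze_cvge _ _ _ _
  (fun n => (series (geometric 1 t) n)%:E) _ (fun=> (1 / (1 - t))%:E) le);
  last exact: cvg_cst.
apply: cvg_EFin; first exact: nearW.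
by apply: cvg_geometric_series; rewrite ger0_norm.
Qed.

Theorem theorem6p3 (R : realType) (M : manifold) :
  (forall (d : nat) (u0 : 'rV[R]_d -> 'rV[R]_d) (N : R),
     (2 <= d)%N -> smooth_field M u0 -> Linf_norm (grad u0) = N%:E ->
     exists u : 'rV[R]_d -> R -> 'rV[R]_d,
       is_the_burgers_solution M [set t | 0 <= t /\ t * N < 1] u0 u /\
       forall t : R, 0 <= t -> t * N < 1 ->
         (Linf_norm (grad (u ^~ t)) <= (N / (1 - t * N))%:E)%E)
  /\
  (exists (u0 : forall d : nat, 'rV[R]_d -> 'rV[R]_d)
          (u : forall d : nat, 'rV[R]_d -> R -> 'rV[R]_d),
     (forall d : nat, (2 <= d)%N ->
        [/\ smooth_field M (u0 d),
            forall x, nilpotent_mx (grad (u0 d) x),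
            Linf_norm (grad (u0 d)) = 1%:E
          & is_the_burgers_solution M [set t | 0 <= t] (u0 d) (u d)]) /\
     forall t : R, 0 <= t <= 1 ->
       (fun d : nat => Linf_norm (grad (u d ^~ t))) @ \oo -->
         (if t == 1 then +oo%E else (1 / (1 - t))%:E)).
Proof.
split=> [d u0 N _ [Mu0 Cu0] uN|]; last first.
  exists (@shear R), (@shear_flow R); split=> [d d2|t t01].
    split; [exact: shear_smooth|exact: grad_shear_nilpotent| |].
      exact: Linf_grad_shear.
    exact: shear_solution.
  exact: Linf_shear_flow_cvg.
have rowN x : rowsum_norm (grad u0 x) <= N.
  by rewrite -lee_fin -uN; exact: rowsum_le_Linf.
have N0 : 0 <= N by apply: le_trans (rowN 0); exact: rowsum_norm_ge0.
have fY := flow_inverse_foot (fun i => Cu0 i 1%N) rowN.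
exists (fun x t => u0 (foot u0 x t)); split.
  apply: (flow_solution fY) => //.
  - by move=> t [t0 tN] /=; rewrite ger0_norm.
  - by rewrite /= mul0r; split.
  - by move=> t [].
  - move=> s t [_ tN] /andP[s0 st]; split=> //.
    by apply: le_lt_trans tN; rewrite ler_wpM2r.
move=> t t0 tN; apply: Linf_norm_le => x.
apply: (rowsum_norm_resolvent t0 tN (rowN (foot u0 x t))).
by apply: (flow_grad x fY); rewrite /= ger0_norm.
Qed.
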